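(* Let $G_1$ and $G_2$ be two connected graphs, each with $n$ vertices and $m$ edges, having signless Laplacian spectra $0<\mu^+_n<\mu^+_{n-1}\leq\cdots\leq\mu^+_1$ and $0<\lambda^+_n<\lambda^+_{n-1}\leq\cdots\leq\lambda^+_1$, respectively. Let $p$ be a positive integer such that $$\frac{2m}{p+n}<\min(\mu^+_{n},\lambda^+_{n}).$$ Then $LE^+(G_1\cup\overline{K_p})=LE^+(G_2\cup\overline{K_p})$.
   Context: All graphs are finite, undirected and simple. For a graph $G$ with $N$ vertices and $M$ edges, adjacency matrix $A(G)$ and diagonal degree matrix $D(G)$, the signless Laplacian matrix is $L^+(G)=D(G)+A(G)$; its eigenvalues with multiplicity, $\mu^+_1,\dots,\mu^+_N$, form the signless Laplacian spectrum of $G$. The signless Laplacian energy is $LE^+(G)=\sum_{i=1}^{N}\left|\mu^+_i-\frac{2M}{N}\right|$. $G\cup H$ denotes the disjoint union of graphs, and $\overline{K_p}$ the graph on $p$ vertices with no edges. *)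

(* Defs.v *)
From mathcomp Require Import all_boot all_order all_algebra.
From mathcomp Require Import complex polyrcf spectral.

Set Implicit Arguments.
Unset Strict Implicit.
Unset Printing Implicit Defensive.

Import Order.TTheory GRing.Theory Num.Theory.

Local Open Scope ring_scope.

Record sgraph := SGraph {
  vertex :> finType;
  adj : rel vertex;
  adj_sym : symmetric adj;
  adj_irrefl : irreflexive adj
}.

Arguments adj : clear implicits.

Definition edges (G : sgraph) : {set {set G}} :=
  [set [set e.1; e.2] | e : G * G & adj G e.1 e.2].

Definition degree (G : sgraph) (x : G) : nat := #|[set y | adj G x y]|.

Definition connected (G : sgraph) : Prop :=
  (0 < #|G|)%N /\ forall x y : G, connect (adj G) x y.

Section Union.
Variables G H : sgraph.

Definition union_adj : rel (G + H) := fun u v =>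
  match u, v with
  | inl x, inl y => adj G x y
  | inr x, inr y => adj H x y
  | _, _ => false
  end.

Lemma union_adj_sym : symmetric union_adj.
Proof. by move=> [x|x] [y|y] //=; exact: adj_sym. Qed.

Lemma union_adj_irrefl : irreflexive union_adj.
Proof. by move=> [x|x] /=; exact: adj_irrefl. Qed.

Definition disjoint_union : sgraph := SGraph union_adj_sym union_adj_irrefl.

End Union.

Definition edgeless (p : nat) : sgraph :=
  @SGraph 'I_p (fun _ _ => false) (fun _ _ => erefl) (fun _ => erefl).

(* The real roots of the characteristic polynomial, each repeated according to
   its multiplicity. By spectrum_symmetric no root is lost when the matrix is
   symmetric. *)
Definition spectrum (R : rcfType) (n : nat) (A : 'M[R]_n) : seq R :=
  flatten [seq nseq (mup x (char_poly A)) x | x <- rootsR (char_poly A)].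

Lemma perm_flatten_mup (R : rcfType) (s : seq R) (q : {poly R}) :
  q = \prod_(x <- s) ('X - x%:P) ->
  perm_eq (flatten [seq nseq (mup x q) x | x <- rootsR q]) s.
Proof.
move=> def_q.
have q_neq0 : q != 0 by rewrite def_q monic_neq0 // monic_prod_XsubC.
apply/allP => a _ /=; apply/eqP.
rewrite -[RHS]mu_prod_XsubC -def_q.
have Ur : uniq (rootsR q) by exact: uniq_roots.
have count_r t : uniq t ->
    count_mem a (flatten [seq nseq (mup x q) x | x <- t]) =
    (if a \in t then mup a q else 0)%N.
  elim: t => //= x t IH /andP[xNt /IH {}IH].
  rewrite count_cat count_nseq IH in_cons /= eq_sym.
  by have [->|] := eqVneq a x; rewrite ?(negPf xNt) ?mul1n ?addn0.
rewrite count_r // -(roots_on_rootsR q_neq0) inE /=.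
by case: ifP => // /negbT /mupNroot ->.
Qed.

Lemma char_poly_similar (F : fieldType) (n : nat) (P D : 'M[F]_n) :
  P \in unitmx -> char_poly (invmx P *m D *m P) = char_poly D.
Proof.
move=> Pu; rewrite /char_poly /char_poly_mx.
have PuX : map_mx (@polyC F) P \in unitmx by rewrite map_unitmx.
have -> : 'X%:M - map_mx (@polyC F) (invmx P *m D *m P) =
  map_mx (@polyC F) (invmx P) *m ('X%:M - map_mx (@polyC F) D)
    *m map_mx (@polyC F) P.
  rewrite !map_mxM mulmxBr mulmxBl; congr (_ - _).
  rewrite -mulmxA -scalar_mxC mulmxA -map_mxM mulVmx //.
  by rewrite map_mx1 mul1mx.
rewrite !det_mulmx mulrAC -det_mulmx -map_mxM mulVmx //.
by rewrite map_mx1 det1 mul1r.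
Qed.

Lemma spectrum_symmetric (R : rcfType) (n : nat) (A : 'M[R]_n) :
  A^T = A -> char_poly A = \prod_(x <- spectrum A) ('X - x%:P).
Proof.
move=> Asym; pose f := real_complex R.
have Aherm : map_mx f A \is hermsymmx.
  apply: realsym_hermsym.
    by apply/is_hermitianmxP; rewrite expr0 scale1r map_mx_id // map_trmx Asym.
  by apply/mxOverP => i j; rewrite mxE; apply/complex_realP; exists (A i j).
have Dreal := hermitian_spectral_diag_real Aherm.
set D := spectral_diag (map_mx f A) in Dreal.
have eqD j : D 0 j = f (complex.Re (D 0 j)).
  by move/mxOverP: Dreal => /(_ 0 j) /complex_realP[k ->].
pose s := [seq complex.Re (D 0 j) | j <- enum 'I_n].
suff def_q : char_poly A = \prod_(x <- s) ('X - x%:P).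
  by rewrite {1}def_q; apply/esym/perm_big/perm_flatten_mup.
apply: (@map_poly_inj _ _ f); rewrite map_char_poly.
have /orthomx_spectralP -> := hermitian_normalmx Aherm.
rewrite char_poly_similar ?spectral_unit // char_poly_trig ?diag_mx_is_trig //.
rewrite rmorph_prod /s big_map big_enum /=; apply: eq_bigr => j _.
by rewrite rmorphB /= map_polyX map_polyC mxE eqxx mulr1n -/D {1}eqD.
Qed.

Definition adjacency (R : rcfType) (G : sgraph) : 'M[R]_#|G| :=
  \matrix_(i, j) (adj G (enum_val i) (enum_val j))%:R.

Definition degree_mx (R : rcfType) (G : sgraph) : 'M[R]_#|G| :=
  diag_mx (\row_i (degree (enum_val i))%:R).

Definition signless_laplacian (R : rcfType) (G : sgraph) : 'M[R]_#|G| :=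
  degree_mx R G + adjacency R G.

Lemma signless_laplacian_sym (R : rcfType) (G : sgraph) :
  (signless_laplacian R G)^T = signless_laplacian R G.
Proof.
rewrite /signless_laplacian linearD /= tr_diag_mx; congr (_ + _).
by apply/matrixP => i j; rewrite !mxE adj_sym.
Qed.

Definition signless_laplacian_energy (R : rcfType) (G : sgraph) : R :=
  \sum_(mu <- spectrum (signless_laplacian R G))
    `|mu - (2 * #|edges G|)%:R / #|G|%:R|.

(* Main.v *)
(* The spectrum of [disjoint_union G (edgeless p)] consists of that of [G] and
   [p] zeros. When the average degree [t] of the union bounds the spectrum of
   [G] from below, the absolute values can be removed, and the energy is
   [\tr L - #|G| t + p t], where [\tr L] is the sum of the degrees, that is
   twice the number of edges. Hence it only depends on the numbers of vertices
   and edges of [G]. *)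
Require Import Defs.
From mathcomp Require Import all_boot all_order all_algebra.
From mathcomp Require Import perm.

Set Implicit Arguments.
Unset Strict Implicit.
Unset Printing Implicit Defensive.

Import Order.TTheory GRing.Theory Num.Theory.
Local Open Scope ring_scope.

(** Relabelling permutes the rows and columns of the characteristic matrix in the same way, so the
    two signs cancel. The sizes [m] and [n] are kept apart because [#|G| + #|H|] and
    [#|disjoint_union G H|] are equal only by a proof. *)
Lemma char_poly_mxsub (R : comNzRingType) (m n : nat) (f : 'I_m -> 'I_n)
    (A : 'M[R]_n) :
  bijective f -> char_poly (mxsub f f A) = char_poly A.
Proof.
move=> f_bij; have def_n := bij_eq_card f_bij; rewrite !card_ord in def_n.
case: n / def_n => [] in f A f_bij *.
pose s := perm (bij_inj f_bij).
rewrite /char_poly.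
have -> : char_poly_mx (mxsub f f A) = row_perm s (col_perm s (char_poly_mx A)).
  by apply/matrixP => i j; rewrite !mxE !permE (inj_eq (bij_inj f_bij)).
rewrite row_permE col_permE !det_mulmx !det_perm odd_permV mulrCA.
by rewrite -expr2 sqrr_sign mulr1.
Qed.

Lemma char_poly_block_diag (R : comNzRingType) (m n : nat)
    (A : 'M[R]_m) (B : 'M[R]_n) :
  char_poly (block_mx A 0 0 B) = char_poly A * char_poly B.
Proof. by rewrite /char_poly char_block_diag_mx det_ublock. Qed.

Lemma size_spectrum (R : rcfType) (n : nat) (A : 'M[R]_n) :
  A^T = A -> size (spectrum A) = n.
Proof.
move=> /spectrum_symmetric/(congr1 (fun q : {poly R} => size q)).
by rewrite size_char_poly size_prod_XsubC => -[].
Qed.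

(** Up to sign, both sides are the coefficient of degree [n.-1] of the characteristic polynomial.
    This makes sense only for positive [n], so the empty matrix is treated apart. *)
Lemma sum_spectrum (R : rcfType) (n : nat) (A : 'M[R]_n) :
  A^T = A -> \sum_(x <- spectrum A) x = \tr A.
Proof.
move=> Asym; have sz := size_spectrum Asym.
have [n0 | n_gt0] := posnP n.
  rewrite (size0nil (etrans sz n0)) big_nil /mxtrace big1 // => i _.
  by case: i => k lt_kn; exfalso; rewrite n0 in lt_kn.
apply: oppr_inj; rewrite -char_poly_trace // (spectrum_symmetric Asym).
by rewrite -{3}sz coefPn_prod_XsubC // sz -lt0n.
Qed.

Section Handshake.
Variable G : sgraph.

Lemma card_edge (E : {set G}) : E \in edges G -> #|E| = 2%N.
Proof.
case/imsetP => -[x y] /= /[1!inE] /= xy ->; rewrite cards2.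
by case: eqVneq xy => // ->; rewrite adj_irrefl.
Qed.

Lemma degree_edges (x : G) : degree x = #|[set E in edges G | x \in E]|.
Proof.
(* Neighbours [y] of [x] correspond to edges [[set x; y]]; injectivity holds because no neighbour
   equals [x]. *)
rewrite /degree -(card_in_imset (f := fun y => [set x; y])); last first.
  move=> y z; rewrite !inE => xy xz /setP/(_ y).
  rewrite !inE eqxx orbT; case: eqVneq => [yx|_ /esym/eqP //].
  by rewrite yx adj_irrefl in xy.
apply: eq_card => E; rewrite inE; apply/imsetP/andP.
  move=> [y]; rewrite inE => xy ->; split; last by rewrite !inE eqxx.
  by apply/imsetP; exists (x, y); rewrite ?inE.
move=> [/imsetP[[a b]] /[1!inE] /= ab ->]; rewrite !inE => /orP[] /eqP ->.
  by exists b => //; rewrite inE.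
by exists a; [rewrite inE adj_sym | rewrite setUC].
Qed.

(** Double counting of the pairs of a vertex and an edge containing it. *)
Lemma handshake : (\sum_(x : G) degree x = 2 * #|edges G|)%N.
Proof.
rewrite mulnC -sum_nat_const.
under eq_bigr => x _ do rewrite degree_edges -sum1_card big_mkcond /=.
rewrite exchange_big [RHS]big_mkcond /=; apply: eq_bigr => E _.
case: ifP => EG; last by rewrite big1 // => x _; rewrite inE EG.
rewrite -(card_edge EG) -sum1_card [RHS]big_mkcond /=.
by apply: eq_bigr => x _; rewrite inE EG.
Qed.

Lemma tr_signless_laplacian (R : rcfType) :
  \tr (signless_laplacian R G) = (2 * #|edges G|)%:R.
Proof.
rewrite -handshake natr_sum [RHS](reindex _ (onW_bij _ (@enum_val_bij G))) /=.
by apply: eq_bigr => i _; rewrite !mxE eqxx mulr1n adj_irrefl addr0.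
Qed.

End Handshake.

Section Union.
Variables G H : sgraph.
Implicit Types (x : G) (y : H).

Lemma degree_inl x : @degree (disjoint_union G H) (inl x) = degree x.
Proof.
rewrite /degree -[RHS](card_imset _ (@inl_inj G H)); apply: eq_card => -[z|z].
  by rewrite (mem_imset _ _ (@inl_inj G H)) !inE.
by rewrite inE /=; apply/esym/imsetP => -[].
Qed.

Lemma degree_inr y : @degree (disjoint_union G H) (inr y) = degree y.
Proof.
rewrite /degree -[RHS](card_imset _ (@inr_inj G H)); apply: eq_card => -[z|z].
  by rewrite inE /=; apply/esym/imsetP => -[].
by rewrite (mem_imset _ _ (@inr_inj G H)) !inE.
Qed.

(** After doubling, [handshake] turns edge counts into degree sums, which split over the sum type;
    this avoids a bijection between edge sets. *)
Lemma card_edges_union :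
  #|edges (disjoint_union G H)| = (#|edges G| + #|edges H|)%N.
Proof.
apply/eqP; rewrite -(eqn_pmul2l (isT : 0 < 2)%N) mulnDr -!handshake.
rewrite big_sumType /=; apply/eqP.
by congr (_ + _)%N; apply: eq_bigr => z _; rewrite (degree_inl, degree_inr).
Qed.

(** Placing [G] before [H] makes the matrix block diagonal, whatever order [enum] gives to the sum
    type. *)
Definition union_rank (k : 'I_(#|G| + #|H|)) : 'I_#|disjoint_union G H| :=
  enum_rank (match split k with
             | inl i => inl (enum_val i)
             | inr j => inr (enum_val j)
             end : disjoint_union G H).

Lemma union_rank_bij : bijective union_rank.
Proof.
apply: inj_card_bij; last by rewrite !card_ord card_sum.
move=> k l /enum_rank_inj; case: (split_ordP k) => i ->;
  by case: (split_ordP l) => j -> // [/enum_val_inj ->].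
Qed.

Lemma signless_laplacian_union (R : rcfType) :
  mxsub union_rank union_rank (signless_laplacian R (disjoint_union G H)) =
  block_mx (signless_laplacian R G) 0 0 (signless_laplacian R H).
Proof.
apply/matrixP => k l; rewrite !mxE (inj_eq (bij_inj union_rank_bij)).
rewrite /union_rank !enum_rankK.
case: (split_ordP k) => i ->; case: (split_ordP l) => j ->.
- by rewrite row_mxEl !mxE degree_inl eq_lshift.
- by rewrite row_mxEr mxE eq_lrshift addr0.
- by rewrite row_mxEl mxE eq_rlshift addr0.
- by rewrite row_mxEr !mxE degree_inr eq_rshift.
Qed.

(** By [perm_flatten_mup], it is enough to factor the characteristic polynomial, which the block
    form does. *)
Lemma spectrum_union (R : rcfType) :
  perm_eq (spectrum (signless_laplacian R (disjoint_union G H)))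
    (spectrum (signless_laplacian R G) ++ spectrum (signless_laplacian R H)).
Proof.
apply: perm_flatten_mup; rewrite big_cat /=.
rewrite -(char_poly_mxsub _ union_rank_bij) signless_laplacian_union.
rewrite char_poly_block_diag.
by rewrite -!spectrum_symmetric //; apply: signless_laplacian_sym.
Qed.

End Union.

Lemma degree_edgeless (p : nat) (x : edgeless p) : degree x = 0%N.
Proof. by apply: eq_card0 => y; rewrite inE. Qed.

Lemma card_edges_edgeless (p : nat) : #|edges (edgeless p)| = 0%N.
Proof.
apply/eqP; rewrite -(eqn_pmul2l (isT : 0 < 2)%N) muln0 -handshake.
by rewrite big1 // => x _; rewrite degree_edgeless.
Qed.

Lemma spectrum_edgeless (R : rcfType) (p : nat) :
  perm_eq (spectrum (signless_laplacian R (edgeless p))) (nseq p 0).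
Proof.
have -> : signless_laplacian R (edgeless p) = 0.
  by apply/matrixP => i j; rewrite !mxE degree_edgeless mul0rn addr0.
apply: perm_flatten_mup; rewrite char_poly_trig; last first.
  by apply/is_trig_mxP => i j; rewrite mxE.
rewrite big_nseq (eq_bigr (fun=> 'X - 0%:P)) => [|i _]; last by rewrite mxE.
by rewrite prodr_const !card_ord iter_mulr_1.
Qed.

Lemma energy_union_edgeless (R : rcfType) (G : sgraph) (p : nat) :
  let t : R := (2 * #|edges G|)%:R / (p + #|G|)%:R in
  {in spectrum (signless_laplacian R G), forall x, t <= x} ->
  signless_laplacian_energy R (disjoint_union G (edgeless p)) =
  (2 * #|edges G|)%:R - t *+ #|G| + t *+ p.
Proof.
move=> t t_le; rewrite /signless_laplacian_energy.
rewrite (perm_big _ (spectrum_union _ _ _)) big_cat.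
rewrite (perm_big _ (spectrum_edgeless _ _)) big_nseq iter_addr_0.
rewrite card_edges_union card_edges_edgeless addn0 card_sum card_ord.
rewrite (addnC #|G|) -/t; congr (_ + _).
  have Lsym := signless_laplacian_sym R G.
  rewrite -tr_signless_laplacian -sum_spectrum //.
  (* The multiple of [t] becomes a sum of [t] over the spectrum, so that the two sides can be
     compared term by term. *)
  rewrite -[X in t *+ X](size_spectrum Lsym).
  rewrite -iter_addr_0 -count_predT -big_const_seq -sumrB.
  by apply: eq_big_seq => x /t_le; rewrite -subr_ge0 => /ger0_norm.
by rewrite sub0r normrN ger0_norm // divr_ge0.
Qed.

(** This extends a bound on the smallest eigenvalue to the whole spectrum, as
    [energy_union_edgeless] requires. *)
Lemma nth_last_sorted_ge (R : rcfType) (n : nat) (s : n.-tuple R) (x : R) :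
  sorted >=%R s -> x \in (s : seq R) -> s`_n.-1 <= x.
Proof.
move=> s_sorted /(nthP 0)[i]; rewrite size_tuple => lt_in <-.
have n_gt0 := leq_ltn_trans (leq0n i) lt_in.
apply: (sorted_leq_nth ge_trans ge_refl 0 s_sorted);
  by rewrite ?inE ?size_tuple ?prednK // -ltnS prednK.
Qed.

(* Sequences are numbered from 0: the eigenvalue mu_i is the item
   i.-1, so that mu`_n.-1 and mu`_n.-2 are the smallest and second smallest. *)
Theorem theorem3p2 (R : rcfType) (G1 G2 : sgraph) (n m p : nat)
    (mu lambda : n.-tuple R) :
  connected G1 -> connected G2 ->
  #|G1| = n -> #|edges G1| = m ->
  #|G2| = n -> #|edges G2| = m ->
  perm_eq mu (spectrum (signless_laplacian R G1)) ->
  sorted >=%R mu -> 0 < mu`_n.-1 -> mu`_n.-1 < mu`_n.-2 ->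
  perm_eq lambda (spectrum (signless_laplacian R G2)) ->
  sorted >=%R lambda -> 0 < lambda`_n.-1 -> lambda`_n.-1 < lambda`_n.-2 ->
  (0 < p)%N ->
  (2 * m)%:R / (p + n)%:R < Num.min mu`_n.-1 lambda`_n.-1 ->
  signless_laplacian_energy R (disjoint_union G1 (edgeless p)) =
  signless_laplacian_energy R (disjoint_union G2 (edgeless p)).
Proof.
move=> _ _ G1n G1m G2n G2m mu_spec mu_sorted _ _ la_spec la_sorted _ _ _.
rewrite lt_min => /andP[lt_mu lt_la].
(* Both energies become the same expression in [n], [m] and [p]; only the lower bounds on the two
   spectra remain to be shown. *)
rewrite !energy_union_edgeless ?G1n ?G1m ?G2n ?G2m // => x.
- rewrite -(perm_mem la_spec) => /(nth_last_sorted_ge la_sorted).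
  by rewrite G2n; apply: le_trans (ltW lt_la).
- rewrite -(perm_mem mu_spec) => /(nth_last_sorted_ge mu_sorted).
  by rewrite G1n; apply: le_trans (ltW lt_mu).
Qed.
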